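(* Let $(\mathbf{A};G,H)$ be a partial dynamic De Morgan algebra (see context) such that (a) $x\in\mathrm{dom}(G)$ implies $G(x)'\in\mathrm{dom}(H)$, and (b) $x\in\mathrm{dom}(H)$ implies $H(x)'\in\mathrm{dom}(G)$. Let $$R_G=\{(s,t)\in T_{\mathbf A}^{\mathrm{DMP}}\times T_{\mathbf A}^{\mathrm{DMP}}\mid \forall x\in\mathrm{dom}(G):\ s(G(x))\leq t(x)\}.$$ Then $(T_{\mathbf A}^{\mathrm{DMP}},R_G)$ is a frame with both $R_G$ and $(R_G)^{-1}$ serial, and $(\mathbf A;G,H)$ can be embedded into $(\mathbf{M}_2^{T_{\mathbf A}^{\mathrm{DMP}}};\widehat G,\widehat H)$, where $\widehat G(p)(s)=\bigwedge_{M_2}\{p(t)\mid s\mathrel{R_G}t\}$ and $\widehat H(p)(s)=\bigwedge_{M_2}\{p(t)\mid t\mathrel{R_G}s\}$; namely, the map $i_{\mathbf A}(a)(s)=s(a)$ is an order-reflecting morphism of De Morgan posets $A\to M_2^{T_{\mathbf A}^{\mathrm{DMP}}}$ with $i_{\mathbf A}(G(a))=\widehat G(i_{\mathbf A}(a))$ for all $a\in\mathrm{dom}(G)$ and $i_{\mathbf A}(H(a))=\widehat H(i_{\mathbf A}(a))$ for all $a\in\mathrm{dom}(H)$.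
   Context: A De Morgan poset is a structure $(A;\leq,{}',0,1)$ where $(A;\leq)$ is a poset with least element $0$ and greatest element $1$, and $'$ is a unary operation with $a\leq b\Rightarrow b'\leq a'$ and $a''=a$. A morphism of De Morgan posets preserves order, negation, $0$, $1$; it is order reflecting if $f(a)\leq f(b)$ iff $a\leq b$. For a partial map $K$ on $A$, its dual $K^{\partial}$ is defined at $a$ iff $a'\in\mathrm{dom}(K)$, by $K^{\partial}(a)=K(a')'$. A partial dynamic De Morgan algebra is a triple $(\mathbf A;G,H)$ with $\mathbf A$ a De Morgan poset and $G,H$ partial maps of $A$ into itself satisfying, with $F=G^{\partial}$ and $P=H^{\partial}$: (P1) $G(0)=0$, $G(1)=1$, $H(0)=0$, $H(1)=1$; (P2) $x\leq y$ implies $G(x)\leq G(y)$ whenever both exist, and $H(x)\leq H(y)$ whenever both exist; (P3) $x\leq G(P(x))$ whenever $H(x')$ and $G(P(x))$ exist, and $x\leq H(F(x))$ whenever $G(x')$ and $H(F(x))$ exist; (P4) $x\leq y$ implies $G(x)\leq F(y)$ whenever $G(y')$ and $G(x)$ exist, and $H(x)\leq P(y)$ whenever $H(y')$ and $H(x)$ exist. A frame is a pair $(T,R)$ with $T$ non-empty and $R\subseteq T\times T$; $R$ is serial if every $x$ has some $y$ with $x\mathrel{R}y$. $\mathbf{M}_2$ is the four-element complete De Morgan lattice on $\{0,1\}\times\{0,1\}$ with componentwise order and $(a,b)'=(1-b,1-a)$; $\mathbf{M}_2^T$ is the direct power with componentwise order and negation. For a proper down-set $D$ of $\mathbf A$ (down-set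 with $0\in D$, $1\notin D$) let $h_D(a)=0$ iff $a\in D$ (else $1$), $h_D^{\partial}(a)=1-h_D(a')$, and $\kappa_D(a)=(h_D(a),h_D^{\partial}(a))\in M_2$. $T_{\mathbf A}^{\mathrm{DMP}}$ is the set of all $\kappa_D$, $D$ ranging over proper down-sets of $\mathbf A$.
   Formalization: The non-emptiness of the frame is claimed only when 0 ≠ 1 in A, since for the one-element De Morgan poset (0 = 1) there is no proper down-set and the set T is empty; seriality and the embedding are stated without this condition. *)

(* Defs.v *)
From HB Require Import structures.
From mathcomp Require Import all_boot all_order.
From mathcomp Require Import boolp classical_sets.

Set Implicit Arguments.
Unset Strict Implicit.
Unset Printing Implicit Defensive.

Import Order.TTheory.
Local Open Scope order_scope.
Local Open Scope classical_set_scope.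

HB.mixin Record isDeMorgan (d : Order.disp_t) T of Order.TBPOrder d T := {
  neg : T -> T;
  neg_anti : forall a b : T, a <= b -> neg b <= neg a;
  negK : involutive neg
}.

(* The trivial case 0 = 1 is not excluded. *)
#[short(type="deMorganPosetType")]
HB.structure Definition DeMorganPoset (d : Order.disp_t) :=
  { T of isDeMorgan d T & Order.TBPOrder d T }.

Definition is_morphism (d d' : Order.disp_t) (A : deMorganPosetType d)
    (B : deMorganPosetType d') (f : A -> B) : Prop :=
  [/\ {homo f : a b / a <= b},
      {morph f : a / neg a >-> neg a},
      f \bot = \bot
    & f \top = \top].

Definition order_reflecting (d d' : Order.disp_t) (A : deMorganPosetType d)
    (B : deMorganPosetType d') (f : A -> B) : Prop :=
  forall a b : A, f a <= f b <-> a <= b.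

(* A partial map K of A into itself is a function A -> option A:
   K x = Some y means that K(x) exists and equals y. *)

Definition dom (A : Type) (K : A -> option A) : set A := [set x | isSome (K x)].

Definition dual_map (d : Order.disp_t) (A : deMorganPosetType d)
    (K : A -> option A) : A -> option A :=
  fun a => omap neg (K (neg a)).

Record partial_dynamic (d : Order.disp_t) (A : deMorganPosetType d)
    (G H : A -> option A) : Prop := PartialDynamic {
  P1G0 : G \bot = Some \bot;
  P1G1 : G \top = Some \top;
  P1H0 : H \bot = Some \bot;
  P1H1 : H \top = Some \top;
  P2G : forall x y gx gy, x <= y -> G x = Some gx -> G y = Some gy -> gx <= gy;
  P2H : forall x y hx hy, x <= y -> H x = Some hx -> H y = Some hy -> hx <= hy;
  P3G : forall x px gpx,
    dual_map H x = Some px -> G px = Some gpx -> x <= gpx;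
  P3H : forall x fx hfx,
    dual_map G x = Some fx -> H fx = Some hfx -> x <= hfx;
  P4G : forall x y gx fy,
    x <= y -> G x = Some gx -> dual_map G y = Some fy -> gx <= fy;
  P4H : forall x y hx py,
    x <= y -> H x = Some hx -> dual_map H y = Some py -> hx <= py
}.

(* R is an arbitrary relation on T; the only condition is on T. *)
Definition is_frame (T : Type) (R : T -> T -> Prop) : Prop := inhabited T.

Definition serial (T : Type) (R : T -> T -> Prop) : Prop :=
  forall x, exists y, R x y.

Definition converse (T : Type) (R : T -> T -> Prop) : T -> T -> Prop :=
  fun x y => R y x.

(* [bool *p bool] carries the componentwise order. *)
Definition M2 : Type := (bool *p bool)%type.
HB.instance Definition _ := Order.FinTBDistrLattice.copy M2 (bool *p bool)%type.

Definition M2_neg (m : M2) : M2 := (~~ m.2, ~~ m.1).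

Lemma M2_neg_anti (a b : M2) : a <= b -> M2_neg b <= M2_neg a.
Proof. by case: a b => [[] []] [[] []]. Qed.

Lemma M2_negK : involutive M2_neg.
Proof. by case=> [[] []]. Qed.

HB.instance Definition _ := isDeMorgan.Build _ M2 M2_neg_anti M2_negK.

(* M2 is finite, so the meet of an arbitrary subset (\top if it is empty) is a
   finite one. *)
Definition M2_inf (S : set M2) : M2 := \meet_(m : M2 | m \in S) m.

(* Direct powers: the componentwise order on [T -> B] is the library's. *)
Section Power.
Variables (T : Type) (d : Order.disp_t) (B : deMorganPosetType d).

Lemma power_le0x (p : T -> B) : (fun=> \bot) <= p.
Proof. by apply/lefP => t; exact: le0x. Qed.

Lemma power_lex1 (p : T -> B) : p <= (fun=> \top).
Proof. by apply/lefP => t; exact: lex1. Qed.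

HB.instance Definition _ := Order.hasBottom.Build _ (T -> B) power_le0x.
HB.instance Definition _ := Order.hasTop.Build _ (T -> B) power_lex1.

Definition power_neg (p : T -> B) : T -> B := fun t => neg (p t).

Lemma power_neg_anti (p q : T -> B) : p <= q -> power_neg q <= power_neg p.
Proof. by move=> /lefP pq; apply/lefP => t; exact/neg_anti/pq. Qed.

Lemma power_negK : involutive power_neg.
Proof. by move=> p; apply/funext => t; exact: negK. Qed.

HB.instance Definition _ :=
  isDeMorgan.Build _ (T -> B) power_neg_anti power_negK.
End Power.

Definition hat_G (T : Type) (R : T -> T -> Prop) (p : T -> M2) : T -> M2 :=
  fun s => M2_inf [set p t | t in [set t | R s t]].

Definition hat_H (T : Type) (R : T -> T -> Prop) (p : T -> M2) : T -> M2 :=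
  fun s => M2_inf [set p t | t in [set t | R t s]].

Section Canonical.
Variables (d : Order.disp_t) (A : deMorganPosetType d).

Definition proper_downset (D : set A) : Prop :=
  [/\ forall a b : A, a <= b -> D b -> D a, D \bot & ~ D \top].

(* The element 0 of {0, 1} is [false]. *)
Definition h_ (D : set A) (a : A) : bool := a \notin D.

Definition h_dual (D : set A) (a : A) : bool := ~~ h_ D (neg a).

Definition kappa (D : set A) : A -> M2 := fun a => (h_ D a, h_dual D a).

Definition T_DMP : set (A -> M2) :=
  [set kappa D | D in [set D | proper_downset D]].

(* T_DMP, used as a type, is the type of its elements; [val] is the inclusion. *)

Definition R_G (G : A -> option A) (s t : T_DMP) : Prop :=
  forall x gx, G x = Some gx -> val s gx <= val t x.

Definition i_ (a : A) : T_DMP -> M2 := fun s => val s a.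

End Canonical.
Arguments T_DMP {d} A.
Arguments i_ {d} A a _.

(* Main.v *)
(** Points of [T_DMP A] correspond to proper down-sets.  For [s = kappa D], a
    point [kappa E] is an [R_G G]-successor of [s] iff [E] contains every [y]
    with [F y] in [D] and omits every [x] with [G x] outside [D], where
    [F := dual_map G].  By (P4) no such [x] lies below such a [y], so the
    down-closure of the required elements is a successor, and by (P2) the
    element [a] may be added to it whenever [G a] lies in [D].  This gives
    seriality and the first component of [hat_G]; the second one follows by
    exchanging the components of all points, which preserves [T_DMP A] and
    [R_G G].  Finally, (P3) and the domain conditions make [R_G H] the converse
    of [R_G G], so the claims about [H] are those about [G] for the pair
    [(H, G)]. *)

Require Import Defs.
From HB Require Import structures.
From mathcomp Require Import all_boot all_order.
From mathcomp Require Import boolp classical_sets.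

Set Implicit Arguments.
Unset Strict Implicit.
Unset Printing Implicit Defensive.

Import Order.TTheory.
Local Open Scope order_scope.
Local Open Scope classical_set_scope.

Lemma M2_leE (m n : M2) : (m <= n) = (m.1 <= n.1) && (m.2 <= n.2).
Proof. by []. Qed.

(** The order is componentwise and each component is two-valued, so a lower bound is the meet once
    each of its [false] components is attained; different members may attain the two. *)
Lemma M2_inf_eq (S : set M2) (m : M2) :
    (forall p, S p -> m <= p) ->
    (m.1 = false -> exists2 p, S p & p.1 = false) ->
    (m.2 = false -> exists2 p, S p & p.2 = false) ->
  M2_inf S = m.
Proof.
move=> mS m1 m2; have infS p : S p -> M2_inf S <= p.
  by move=> Sp; apply: meets_inf; rewrite inE.
apply/eqP; rewrite eq_le; apply/andP; split; last first.
  by apply/meetsP => p; rewrite inE; exact: mS.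
rewrite M2_leE; apply/andP; split.
  case: m.1 m1 => [_|/(_ erefl)[p /infS]]; first exact: lex1.
  by rewrite M2_leE => /andP[+ _] => /[swap] ->.
case: m.2 m2 => [_|/(_ erefl)[p /infS]]; first exact: lex1.
by rewrite M2_leE => /andP[_ +] => /[swap] ->.
Qed.

Section DeMorganPosetTheory.
Variables (d : Order.disp_t) (A : deMorganPosetType d).
Implicit Types (D E : set A) (s t : T_DMP A) (a b x y : A).

Lemma leNl a b : neg a <= b -> neg b <= a.
Proof. by move=> /neg_anti; rewrite negK. Qed.

Lemma neg_bot : neg (\bot : A) = \top.
Proof. by apply/eqP; rewrite -le1x -[leLHS]negK; apply/neg_anti/le0x. Qed.

Lemma neg_top : neg (\top : A) = \bot.
Proof. by rewrite -neg_bot negK. Qed.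

Lemma kappa_T_DMP D : proper_downset D -> kappa D \in T_DMP A.
Proof. by move=> pD; rewrite inE; exists D. Qed.

Lemma kappa_point D :
  proper_downset D -> exists s : T_DMP A, val s = kappa D.
Proof. by move=> /kappa_T_DMP kD; exists (SigSub kD). Qed.

Lemma point_kappa s : exists2 D, proper_downset D & val s = kappa D.
Proof. by case: s => s /= /[!inE] -[D pD <-]; exists D. Qed.

Lemma h_falseP D a : h_ D a = false <-> D a.
Proof. by rewrite /h_; split=> [/negbFE|Da]; rewrite ?inE// mem_set. Qed.

Lemma le_h D E a b : h_ D a <= h_ E b <-> (E b -> D a).
Proof.
split=> [+ /h_falseP Eb|DE]; last first.
  case Eb: (h_ E b); first exact: lex1.
  by move/h_falseP: Eb => /DE/h_falseP ->.
by rewrite Eb => DE; apply/h_falseP; move: DE; case: (h_ D a).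
Qed.

(** The second component negates [h_], so its inequality becomes an implication in the opposite
    direction, at the negated arguments. *)
Lemma le_kappa D E a b :
  kappa D a <= kappa E b <-> (E b -> D a) /\ (D (neg a) -> E (neg b)).
Proof.
have -> : (kappa D a <= kappa E b) =
    (h_ D a <= h_ E b) && (h_ E (neg b) <= h_ D (neg a)).
  by rewrite M2_leE /= /h_dual; do 2!case: (h_ _ (neg _)).
by split=> [/andP[/le_h ? /le_h ?]|[/le_h -> /le_h ->]].
Qed.

Lemma kappa_neg D a : kappa D (neg a) = neg (kappa D a).
Proof. by rewrite /kappa /h_dual negK [RHS]/neg /= /M2_neg /= negbK. Qed.

Lemma kappa_bot D : proper_downset D -> kappa D \bot = \bot.
Proof.
move=> [_ /h_falseP D0 /h_falseP D1].
by rewrite /kappa /h_dual neg_bot D0; case: h_ D1.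
Qed.

Lemma kappa_top D : proper_downset D -> kappa D \top = \top.
Proof.
by move=> pD; rewrite -neg_bot kappa_neg kappa_bot.
Qed.

Lemma downset_separation (L U : set A) :
    L \bot -> U \top -> (forall x y, U x -> L y -> ~ x <= y) ->
  exists E, [/\ proper_downset E, L `<=` E & forall x, U x -> ~ E x].
Proof.
(* The down-closure of [L] avoids [U] by [UL], hence omits [\top]. *)
move=> L0 U1 UL; exists [set x | exists2 y, L y & x <= y]; split.
- split=> [a b ab [y Ly]||[y Ly]]; last exact: UL.
  + by move=> /(le_trans ab); exists y.
  + by exists \bot.
- by move=> y Ly; exists y.
- by move=> x Ux [y Ly]; exact: UL.
Qed.

Lemma downset_le_separation a b :
  ~ a <= b -> exists D, [/\ proper_downset D, D b & ~ D a].
Proof.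
(* Separate the principal down-set of [b] from the principal up-set of [a]. *)
move=> nab; have [|||D [pD bD aD]] :=
  @downset_separation [set y | y <= b] [set x | a <= x].
- exact: le0x.
- exact: lex1.
- by move=> x y /= ax yb xy; apply: nab; exact: le_trans ax (le_trans xy yb).
by exists D; split=> //; [apply: bD|apply: aD] => /=.
Qed.

(** If [\bot = \top], no down-set is proper and there are no points. *)
Lemma point_exists : (\bot : A) <> \top -> inhabited (T_DMP A).
Proof.
move=> neq01; have [|D [pD _ _]] := @downset_le_separation \top \bot.
  by rewrite le1x => /eqP.
by have [s _] := kappa_point pD.
Qed.

Lemma i_morphism : is_morphism (i_ A).
Proof.
split.
- move=> a b ab; apply/lefP => s; rewrite /i_.
  have [D [down _ _] ->] := point_kappa s; apply/le_kappa; split.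
    exact: down.
  exact/down/neg_anti.
- move=> a; apply/funext => s; rewrite [RHS]/neg /= /power_neg /i_.
  by have [D _ ->] := point_kappa s; rewrite kappa_neg.
- apply/funext => s; rewrite /i_.
  by have [D pD ->] := point_kappa s; rewrite kappa_bot.
- apply/funext => s; rewrite /i_.
  by have [D pD ->] := point_kappa s; rewrite kappa_top.
Qed.

Lemma i_reflecting : order_reflecting (i_ A).
Proof.
move=> a b; split; last by have [homo_i _ _ _] := i_morphism; exact: homo_i.
move=> /lefP iab; apply: contrapT => /downset_le_separation[D [pD Db nDa]].
have [s sD] := kappa_point pD.
by move: (iab s); rewrite /i_ sD => /le_kappa[/(_ Db)].
Qed.

Lemma swap_point s : exists t, forall a, val t a = ((val s a).2, (val s a).1).
Proof.
have [D [down D0 D1] ->] := point_kappa s.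
(* Chosen so that [h_ E] is [h_dual D]; dualizing again gives back [h_ D]. *)
pose E := [set a | ~ D (neg a)].
have [|t tE] := @kappa_point E.
  split; rewrite /E /= ?neg_bot ?neg_top; [|by []|exact].
  by move=> a b ab nDb Da; apply: nDb; apply: down Da; exact: neg_anti.
have hE a : h_ E a = h_dual D a.
  rewrite /h_dual /h_ negbK; apply/idP/idP => [/negP|].
    by rewrite !inE => /contrapT.
  by rewrite inE => Dna; apply/negP; rewrite inE => /(_ Dna).
by exists t => a; rewrite tE /kappa /= hE /h_dual hE /h_dual negK negbK.
Qed.

Lemma R_G_swap (G : A -> option A) s t s' t' :
    (forall a, val s' a = ((val s a).2, (val s a).1)) ->
    (forall a, val t' a = ((val t a).2, (val t a).1)) ->
  R_G G s t -> R_G G s' t'.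
Proof.
move=> ss tt st x gx Gx; move: (st x gx Gx).
by rewrite ss tt !M2_leE andbC.
Qed.

End DeMorganPosetTheory.

Section PartialDynamic.
Variables (d : Order.disp_t) (A : deMorganPosetType d) (G H : A -> option A).
Hypothesis AGH : partial_dynamic G H.
Implicit Types (s t : T_DMP A) (a x y : A).

Lemma partial_dynamicC : partial_dynamic H G.
Proof. by case: AGH. Qed.

Lemma successor1 s a ga :
    G a = Some ga -> (val s ga).1 = false ->
  exists2 t, R_G G s t & (val t a).1 = false.
Proof.
have [D [down D0 D1] sD] := point_kappa s.
move=> Ga; rewrite sD => /h_falseP Dga.
(* [L] holds [a] and the elements forced into the down-set of a successor, [neg gy] being the value
   of [F] at [y]; [U] holds the forbidden ones. *)
pose L := [set y | y = a \/ exists2 gy, G (neg y) = Some gy & D (neg gy)].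
pose U := [set x | exists2 gx, G x = Some gx & ~ D gx].
have [|||E [pE LE UE]] := @downset_separation _ A L U.
- by right; exists \top; rewrite ?neg_bot ?neg_top// (P1G1 AGH).
- by exists \top; first exact: (P1G1 AGH).
(* An element of [U] below [a] contradicts (P2), as [ga] is in [D]; one below a forced element
   contradicts (P4). *)
- move=> x y [gx Gx nDgx] [->|[gy Gy Dgy]] xy; apply: nDgx.
    exact: down (P2G AGH xy Gx Ga) Dga.
  by apply: down Dgy; apply: (P4G AGH xy Gx); rewrite /dual_map Gy.
have [t tE] := kappa_point pE; exists t; last first.
  by rewrite tE; apply/h_falseP/LE; left.
move=> x gx Gx; rewrite sD tE; apply/le_kappa; split=> [|Dgx].
  by apply: contraPP => nDgx; apply: UE; exists gx.
(* The forced element is [neg x], where [F] takes the value [neg gx]. *)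
by apply: LE; right; exists gx; rewrite ?negK.
Qed.

Lemma successor2 s a ga :
    G a = Some ga -> (val s ga).2 = false ->
  exists2 t, R_G G s t & (val t a).2 = false.
Proof.
move=> Ga sga; have [s' ss'] := swap_point s.
have [|t' st' ta] := @successor1 s' a ga Ga; first by rewrite ss'.
have [t tt'] := swap_point t'; exists t; last by rewrite tt'.
(* Exchanging components twice leads back to [s]. *)
by apply: R_G_swap st' => // b; rewrite ss' -surjective_pairing.
Qed.

Lemma R_G_serial : serial (R_G G).
Proof.
(* Every point sends [G \bot = \bot] to [\bot], so [successor1] applies to [\bot]. *)
move=> s; have [|t st _] := successor1 (s := s) (P1G0 AGH); last by exists t.
by have [D pD ->] := point_kappa s; rewrite kappa_bot.
Qed.

Lemma i_hat_G a ga : G a = Some ga -> i_ A ga = hat_G (R_G G) (i_ A a).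
Proof.
move=> Ga; apply/funext => s; apply/esym/M2_inf_eq.
- by move=> _ [t st <-]; exact: st.
- by move=> /(successor1 Ga)[t st ta]; exists (val t a) => //; exists t.
- by move=> /(successor2 Ga)[t st ta]; exists (val t a) => //; exists t.
Qed.

Lemma R_G_converse s t :
  (forall x hx, H x = Some hx -> dom G (neg hx)) -> R_G G s t -> R_G H t s.
Proof.
move=> domH st x hx Hx; have := domH _ _ Hx; rewrite /dom/mkset.
case Ghx: (G (neg hx)) => [g|//] _.
(* (P3) at [neg x], where [P] takes the value [neg hx]; [domH] makes [G] defined there. *)
have xg : neg x <= g by apply: (P3G AGH _ Ghx); rewrite /dual_map negK Hx.
move: (st _ _ Ghx).
have [D [down _ _] ->] := point_kappa s; have [E _ ->] := point_kappa t.
move=> /le_kappa; rewrite negK => -[EDg DgE]; apply/le_kappa; split=> [Dx|Ehx].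
  by apply: DgE; apply: down Dx; exact: leNl.
by apply: down xg _; exact: EDg.
Qed.

End PartialDynamic.

Theorem mainTheorem4 (d : Order.disp_t) (A : deMorganPosetType d)
    (G H : A -> option A)
    (AGH : partial_dynamic G H)
    (domG : forall x gx, G x = Some gx -> dom H (neg gx))
    (domH : forall x hx, H x = Some hx -> dom G (neg hx)) :
  [/\ ((\bot : A) <> \top -> is_frame (R_G G)),
      serial (R_G G) /\ serial (converse (R_G G)),
      is_morphism (i_ A) /\ order_reflecting (i_ A),
      (forall a ga, G a = Some ga -> i_ A ga = hat_G (R_G G) (i_ A a))
    & (forall a ha, H a = Some ha -> i_ A ha = hat_H (R_G G) (i_ A a))].
Proof.
have AHG := partial_dynamicC AGH.
(* The first inclusion uses [domH], the second [domG]. *)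
have convE : converse (R_G G) = R_G H.
  apply/funext => s; apply/funext => t; apply/propext; split.
    exact: R_G_converse.
  exact: (R_G_converse AHG).
split.
- exact: point_exists.
- by rewrite convE; split; [exact: R_G_serial AGH|exact: R_G_serial AHG].
- by split; [exact: i_morphism|exact: i_reflecting].
- exact: i_hat_G AGH.
(* [hat_H R] is [hat_G (converse R)] by definition. *)
- by move=> a ha /(i_hat_G AHG); rewrite -convE.
Qed.
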